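(* Let $M$ be a compact metric space with metric $d$ and let $\phi:\mathbb{R}\times M\to M$ be a continuous flow without fixed points. If $\phi$ is separating, then $\phi$ has quasi-trivial centralizer; that is, for every continuous flow $\psi:\mathbb{R}\times M\to M$ with $\psi_s\circ\phi_t=\phi_t\circ\psi_s$ for all $s,t\in\mathbb{R}$, there exists a continuous function $A:M\to\mathbb{R}$ such that $A(\phi_t(x))=A(x)$ and $\psi_t(x)=\phi_{A(x)t}(x)$ for every $(t,x)\in\mathbb{R}\times M$.
   Context: A continuous flow $\phi:\mathbb{R}\times M\to M$ is a continuous action of $(\mathbb{R},+)$ on $M$; write $\phi_t=\phi(t,\cdot)$. The orbit of $x$ is $Orb(x,\phi)=\{\phi_t(x): t\in\mathbb{R}\}$, and $x$ is a fixed point if $Orb(x,\phi)=\{x\}$. The flow $\phi$ is separating if there exists $\delta>0$ such that for all $x,y\in M$: if $d(\phi_t(x),\phi_t(y))<\delta$ for all $t\in\mathbb{R}$, then $y\in Orb(x,\phi)$. *)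

(* Defs.v *)
From HB Require Import structures.
From mathcomp Require Import all_boot all_order all_algebra.
From mathcomp Require Import all_classical all_reals all_analysis.

Set Implicit Arguments.
Unset Strict Implicit.
Unset Printing Implicit Defensive.

Import Order.TTheory GRing.Theory Num.Theory.
Import numFieldNormedType.Exports.

Local Open Scope classical_set_scope.
Local Open Scope ring_scope.

(* Continuity is joint in time and space, i.e. with respect to the product
   topology on R * M. *)
Definition continuous_flow (R : realType) (M : topologicalType)
    (phi : R -> M -> M) : Prop :=
  [/\ continuous (fun p : R * M => phi p.1 p.2),
      forall x, phi 0 x = x &
      forall s t x, phi (s + t) x = phi s (phi t x)].

Definition flow_orbit (R : realType) (M : Type) (phi : R -> M -> M) (x : M) :
  set M := [set phi t x | t in [set: R]].

Definition flow_fixed_point (R : realType) (M : Type) (phi : R -> M -> M)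
  (x : M) : Prop := flow_orbit phi x = [set x].

Definition separating (R : realType) (M : metricType R) (phi : R -> M -> M) :
    Prop :=
  exists2 delta : R, 0 < delta &
    forall x y : M, (forall t : R, mdist (phi t x) (phi t y) < delta) ->
      flow_orbit phi x y.

Definition quasi_trivial_centralizer (R : realType) (M : topologicalType)
    (phi : R -> M -> M) : Prop :=
  forall psi : R -> M -> M,
    continuous_flow psi ->
    (forall s t : R, psi s \o phi t = phi t \o psi s) ->
    exists A : M -> R,
      [/\ continuous A,
          forall (t : R) (x : M), A (phi t x) = A x &
          forall (t : R) (x : M), psi t x = phi (A x * t) x].

(* Main.v *)
(** For a flow psi commuting with phi, psi_s is uniformly close to the identity
    for small s, hence moves each point x inside its phi-orbit.  The closed
    subgroup of all (s, t) in R * R with psi_s x = phi_t x is thus uncountable,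
    hence not discrete, hence contains a line by compactness of the unit circle.
    The line is not vertical because x is not fixed by phi; its slope is A x,
    unique for the same reason, so A is phi-invariant.  The relation
    psi_(r a) y = phi_(r b) y for all r is closed in (y, (a, b)), so compactness
    of the circle of directions (a, b) makes A continuous; working with
    directions rather than slopes avoids having to bound A beforehand. *)
Require Import Defs.
From mathcomp Require Import all_boot all_order all_algebra.
From mathcomp Require Import all_classical all_reals all_analysis.
From mathcomp Require Import lra.
Import Order.TTheory GRing.Theory Num.Theory.
Import numFieldNormedType.Exports.
Local Open Scope classical_set_scope.
Local Open Scope ring_scope.

(** * Closed subgroups and the lines they contain *)

Definition subgroup_set {V : zmodType} (G : set V) : Prop :=
  G 0 /\ forall u v, G u -> G v -> G (u - v).

Lemma subgroup_set_mulrz {V : zmodType} (G : set V) (v : V) (n : int) :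
  subgroup_set G -> G v -> G (v *~ n).
Proof.
move=> [G0 GB] Gv.
have GN u : G u -> G (- u) by move=> Gu; rewrite -sub0r; exact: GB.
elim: n => [|n IHn|n IHn]; first by rewrite mulr0z.
- rewrite intS mulrzDr mulr1z addrC -[X in _ + X]opprK.
  by apply: GB; last exact: GN.
- rewrite intS opprD mulrzDr mulrNz mulr1z addrC; exact: GB.
Qed.

Definition nondiscrete_at0 {R : realType} {V : normedModType R} (G : set V)
    : Prop :=
  forall e : R, 0 < e -> exists v, [/\ G v, v != 0 & `|v| < e].

(* If r w is not in G, then no short vector of G points in a direction close
   to w, because one of its integer multiples would come close to r w. *)
Lemma closed_subgroup_line {R : realType} {V : normedModType R} (G : set V) :
  compact [set v : V | `|v| = 1] -> closed G -> subgroup_set G ->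
  nondiscrete_at0 G ->
  exists2 w, `|w| = 1 & forall r : R, G (r *: w).
Proof.
move=> cS clG sG ndG; apply: contrapT => noline.
have off w : `|w| = 1 -> exists r : R, ~ G (r *: w).
  by move=> w1; apply: contrapT => /forallNP h; apply: noline; exists w => // r;
    apply: contrapT; exact: h.
(* Compactness makes one bound [e] serve all directions. The unit-norm premise is repeated inside
   the predicate because the nearby [w] range over all of [V]. *)
have cov : \forall e \near (0:R)^'+, [set v : V | `|v| = 1] `<=`
    (fun w => forall h : R, 0 < h < e -> `|w| = 1 -> ~ G (h *: w)).
  apply: (iffLR (compact_near_coveringP _) cS R (0^'+)
    (fun e w => forall h : R, 0 < h < e -> `|w| = 1 -> ~ G (h *: w))).
  move=> x /= x1; have [r nG] := off x x1.
  have /nbhs_ballP[d /= d0 dG] : nbhs (r *: x) (~` G).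
    by apply: open_nbhs_nbhs; split => //; exact: closed_openC.
  have r1 : 0 < `|r| + 1 by rewrite ltr_wpDl.
  near=> w e => h /= /andP[h0 he] w1 Ghw.
  (* As n h is within h of r, the n-th multiple of [h *: w] is within |r| |x - w| + h < d of
     [r *: x]. *)
  pose n := Num.floor (r / h).
  apply: (dG ((h *: w) *~ n)); last exact: subgroup_set_mulrz.
  rewrite -ball_normE /=.
  have -> : r *: x - h *: w *~ n = r *: (x - w) + (r - n%:~R * h) *: w.
    by rewrite scalerBr scalerBl addrA subrK -scaler_int scalerA.
  rewrite (le_lt_trans (ler_normD _ _))// !normrZ w1 mulr1.
  have rx : `|r| * `|x - w| <= d / 2.
    have xw : `|x - w| <= d / 2 / (`|r| + 1).
      near: w; apply: (filterS (P := ball x (d / 2 / (`|r| + 1)))).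
        by move=> w; rewrite -ball_normE => /ltW.
      by apply: nbhsx_ballx; rewrite !divr_gt0.
    rewrite (le_trans (ler_wpM2l (normr_ge0 r) xw))// mulrCA.
    rewrite ler_piMr//; first lra.
    by rewrite ler_pdivrMr// mul1r lerDl.
  have rn : `|r - n%:~R * h| <= h.
    have /andP[] := floor_itv (r / h).
    rewrite -/n ler_pdivlMr// intrD ltr_pdivrMr// mulrDl mul1r => n1 n2.
    by rewrite ler_norml; apply/andP; split; lra.
  have ed : e < d / 2 by near: e; apply: nbhs_right_lt; rewrite divr_gt0.
  by move: he => /= he; lra.
have [e [e0 /= cove]] : exists e : R, 0 < e /\ [set v : V | `|v| = 1] `<=`
    (fun w => forall h : R, 0 < h < e -> `|w| = 1 -> ~ G (h *: w)).
  have pos : \forall e \near (0:R)^'+, 0 < e by exact: nbhs_right_gt.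
  by have [e [? ?]] := filter_ex (filterI pos cov); exists e.
have [v [Gv v0 ve]] := ndG e e0.
have nv : 0 < `|v| by rewrite normr_gt0.
have u1 : `| `|v|^-1 *: v| = 1.
  by rewrite normrZ normfV normr_id mulVf// gt_eqF.
apply: (cove _ u1 `|v| _ u1); first by rewrite nv.
by rewrite scalerA mulfV ?gt_eqF// scale1r.
Unshelve. all: by end_near. Qed.

(* A subgroup of R * R isolated at 0 is countable, while this one projects onto
   an interval. *)
Lemma nondiscrete_graph {R : realType} (G : set (R * R)) (eta : R) :
  0 < eta -> subgroup_set G ->
  (forall s, `|s| < eta -> exists t, G (s, t)) ->
  nondiscrete_at0 G.
Proof.
move=> eta0 [_ GB] surj e e0; apply: contrapT => disc.
have /choice[t Gt] : forall s : R, exists t, `|s| < eta -> G (s, t).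
  move=> s; have [/surj[u Gu]|ns] := pselect (`|s| < eta); first by exists u.
  by exists 0.
pose I : set R := `]- eta, eta[%classic.
have IE s : I s -> `|s| < eta by rewrite /I /= in_itv /= ltr_norml.
pose q (s : R) := Num.floor (s / e).
have qe a b : q a = q b -> `|a - b| < e.
  move=> qab; have /andP[] := floor_itv (a / e).
  have /andP[] := floor_itv (b / e).
  rewrite -/(q a) -/(q b) qab intrD !ler_pdivlMr// !ltr_pdivrMr// mulrDl mul1r.
  by move=> *; rewrite ltr_norml; apply/andP; split; lra.
have cI : countable I.
  (* Each [s] is sent to the grid cell of side [e] containing (s, t s). Two points in one cell would
     differ by a nonzero element of [G] shorter than [e]. *)
  apply/pcard_injP; exists (fun s => pickle (q s, q (t s))) => a b.
  move=> /set_mem/IE Ia /set_mem/IE Ib /(pcan_inj pickleK)[/qe ab /qe tab].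
  apply: contrapT => anb; apply: disc; exists (a - b, t a - t b).
  split; first exact: (GB _ _ (Gt a Ia) (Gt b Ib)).
    by apply/negP => /eqP[/eqP]; rewrite subr_eq0 => /eqP.
  by rewrite prod_normE /= gt_max ab tab.
(* A countable [I] would be null, but its length is 2 eta. *)
have := countable_lebesgue_measure0 cI.
rewrite lebesgue_measure_itv /= lte_fin ifT; last lra.
by move=> /eqP; rewrite -EFinD eqe opprK gt_eqF// addr_gt0.
Qed.

(** * Compactness and continuity tools for flows *)

Lemma compact_unit_sphere_prod (R : realType) :
  compact [set v : R * R | `|v| = 1].
Proof.
have cB : compact ((`[-1, 1] : set R) `*` (`[-1, 1] : set R)).
  by apply: compact_setX; exact: segment_compact.
apply: (subclosed_compact _ cB).
- apply: (@preimage_closed _ _ (fun v : R * R => `|v|) [set x : R | x = 1]).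
    by move=> v _; exact: norm_continuous.
  exact: closed_eq.
- move=> [a b] /= ab; rewrite !in_itv /= -!ler_norml -ab prod_normE /=.
  by rewrite !le_max !lexx orbT.
Qed.

Lemma closed_equalizer {T U : topologicalType} (f g : T -> U) :
  hausdorff_space U -> continuous f -> continuous g ->
  closed [set x | f x = g x].
Proof.
move=> hU cf cg x clx; apply: hU => A B fA gB.
have nAB : nbhs x (f @^-1` A `&` g @^-1` B).
  by apply: filterI; [exact: cf|exact: cg].
have [y [/= fg [Ay By]]] := clx _ nAB.
by exists (f y); split => //; rewrite fg.
Qed.

Lemma continuous_flow_comp {R : realType} {M : metricType R}
    (phi : R -> M -> M) {T : topologicalType} (u : T -> R) (y : T -> M) :
  continuous_flow phi -> continuous u -> continuous y ->
  continuous (fun z => phi (u z) (y z)).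
Proof.
move=> [cphi _ _] cu cy z.
by apply: continuous2_cvg; [exact: (cphi (u z, y z))|exact: cu|exact: cy].
Qed.

(** Compactness of [M] makes continuity at time 0 uniform in the point. *)
Lemma flow_small_time {R : realType} {M : metricType R} (psi : R -> M -> M)
    (delta : R) :
  compact [set: M] -> continuous_flow psi -> 0 < delta ->
  exists2 eta, 0 < eta &
    forall s x, `|s| < eta -> mdist x (psi s x) < delta.
Proof.
move=> cM [cpsi psi0 _] d0.
have near0 : \forall s \near (0 : R), [set: M] `<=`
    (fun x => mdist x (psi s x) < delta).
  apply: (iffLR (compact_near_coveringP _) cM R (nbhs 0)
    (fun s x => mdist x (psi s x) < delta)) => x _.
  have d2 : 0 < delta / 2 by rewrite divr_gt0.
  have : \forall p \near ((0 : R), x), ball x (delta / 2) (psi p.1 p.2).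
    by apply: (cpsi (0, x)); rewrite /= psi0; exact: nbhsx_ballx.
  (* The point [y] varies too: both [y] and [psi s y] must be within [delta / 2] of [x]. *)
  case=> -[A B] /= [A0 Bx] AB; exists (B `&` ball x (delta / 2), A).
    by split => //=; apply: filterI => //; exact: nbhsx_ballx.
  move=> [y s] /= [[By yx] As].
  have := ball_splitr yx (AB (s, y) (conj As By)); by rewrite ballEmdist.
have [eta /= eta0 sub] := iffLR (nbhs_ballP _ _) near0.
exists eta => // s x se; apply: (sub s) => //.
by rewrite -ball_normE /= sub0r normrN.
Qed.

(** Every time is a real multiple of a nonzero [a], so the orbit would reduce to [x]. *)
Lemma not_fixed_period0 {R : realType} {M : metricType R} (phi : R -> M -> M)
    (x : M) (a : R) :
  phi 0 x = x -> ~ flow_fixed_point phi x ->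
  (forall r, phi (r * a) x = x) -> a = 0.
Proof.
move=> phi0 nfix pa; apply: contrapT => /eqP a0; apply: nfix.
apply/seteqP; split => y /=; last by move=> ->; exists 0.
by move=> [t _ <-]; rewrite -[t](divfK a0) pa.
Qed.

(** * Slopes for a pair of commuting flows *)

Section commuting.
Context {R : realType} {M : metricType R} {phi psi : R -> M -> M}.
Hypotheses (fphi : continuous_flow phi) (fpsi : continuous_flow psi).
Hypothesis comm : forall s t : R, psi s \o phi t = phi t \o psi s.

Lemma commuting_flow s t x : psi s (phi t x) = phi t (psi s x).
Proof. exact: (congr1 (fun f => f x) (comm s t)). Qed.

Definition coincidence (x : M) : set (R * R) :=
  [set v | psi v.1 x = phi v.2 x].

Lemma closed_coincidence x : closed (coincidence x).
Proof.
apply: (@closed_equalizer _ M (fun v : R * R => psi v.1 x)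
  (fun v => phi v.2 x)); first exact: metric_hausdorff.
- by apply: continuous_flow_comp => // v; [exact: cvg_fst|exact: cvg_cst].
- by apply: continuous_flow_comp => // v; [exact: cvg_snd|exact: cvg_cst].
Qed.

Lemma subgroup_coincidence x : subgroup_set (coincidence x).
Proof.
have [_ phi0 phiD] := fphi; have [_ psi0 psiD] := fpsi.
split=> [|[s t] [s' t']]; first by rewrite /coincidence /= psi0 phi0.
rewrite /coincidence /= => st st'.
(* Write x as phi_{-t'}(phi_{t'} x) = phi_{-t'}(psi_{s'} x), then move psi_{-s'} inside to cancel
   psi_{s'}. *)
have h : psi (- s') x = phi (- t') x.
  rewrite -[x in LHS]phi0 -(addNr t') phiD commuting_flow -st'.
  by rewrite -psiD addNr psi0.
by rewrite psiD h commuting_flow st addrC phiD.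
Qed.

Definition proportional (x : M) (w : R * R) : Prop :=
  forall r, psi (r * w.1) x = phi (r * w.2) x.

(** For every r, phi at time r (w.2 - a w.1) fixes x. *)
Lemma slope_unique x (w : R * R) (a : R) : ~ flow_fixed_point phi x ->
  proportional x w -> (forall s, psi s x = phi (a * s) x) ->
  w.2 = a * w.1.
Proof.
have [_ phi0 phiD] := fphi => nfix lw ha.
apply/eqP; rewrite -subr_eq0; apply/eqP.
apply: (not_fixed_period0 phi x) => // r.
have := lw r; rewrite ha => h.
by rewrite mulrBr addrC phiD -h -phiD mulrCA addNr phi0.
Qed.

Lemma slope_exists x eta : ~ flow_fixed_point phi x -> 0 < eta ->
  (forall s, `|s| < eta -> flow_orbit phi x (psi s x)) ->
  exists a, forall s, psi s x = phi (a * s) x.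
Proof.
have [_ phi0 _] := fphi; have [_ psi0 _] := fpsi => nfix eta0 orb.
have [||||w w1 line] := @closed_subgroup_line R (R * R)%type (coincidence x).
- exact: compact_unit_sphere_prod.
- exact: closed_coincidence.
- exact: subgroup_coincidence.
- apply: (nondiscrete_graph _ _ eta0 (subgroup_coincidence x)).
  by move=> s /orb[t _ st]; exists t.
have lw : proportional x w by move=> r; exact: line.
(* On a vertical line [psi] does not move [x], so [phi] fixes [x] at all multiples of [w.2]; then w
   = 0, against the unit norm. *)
have w10 : w.1 != 0.
  apply/eqP => w10; have w20 : w.2 = 0.
    apply: (not_fixed_period0 phi x) => // r.
    by have := lw r; rewrite w10 mulr0 psi0.
  move: w1; rewrite prod_normE w10 w20 normr0 maxxx => /eqP.
  by rewrite eq_sym oner_eq0.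
exists (w.2 / w.1) => s; have := lw (s / w.1).
by rewrite divfK// => ->; rewrite -mulrA mulrC [_^-1 * _]mulrC.
Qed.

Lemma continuous_slope (A : M -> R) : (forall x, ~ flow_fixed_point phi x) ->
  (forall s x, psi s x = phi (A x * s) x) -> continuous A.
Proof.
move=> nfix hA x.
apply/cvgrPdist_lt => e e0.
(* The estimate |w.2 / w.1 - A x| < e with the denominator cleared, so that it makes sense for
   vertical directions, where it is false. *)
pose P (y : M) (w : R * R) := `|w| = 1 -> proportional y w ->
  `|w.2 - A x * w.1| < e * `|w.1|.
have : \forall y \near x, [set w : R * R | `|w| = 1] `<=` P y.
  apply: (iffLR (compact_near_coveringP _) (compact_unit_sphere_prod R)
    M (nbhs x) P).
  (* If [w] is proportional at [x], the estimate holds at [w] and is open. Otherwise proportionality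
     fails at some [r], and still fails for nearby directions and points. *)
  move=> w /= w1; have [lw|/existsNP[r nr]] := pselect (proportional x w).
    have wA := slope_unique x w (A x) (nfix x) lw (fun s => hA s x).
    have w10 : w.1 != 0.
      apply/eqP => w10; move: w1; rewrite prod_normE wA w10 mulr0 normr0 maxxx.
      by move=> /eqP; rewrite eq_sym oner_eq0.
    have : \forall v \near w, `|v.2 - A x * v.1| < e * `|v.1|.
      have ow : open [set v : R * R | 0 < e * `|v.1| - `|v.2 - A x * v.1|].
        apply: (@open_comp _ _
          (fun v : R * R => e * `|v.1| - `|v.2 - A x * v.1|) [set z | 0 < z]);
          last exact: open_gt.
        move=> v _; apply: cvgB.
          by apply: (cvgM (cvg_cst _)); apply: cvg_norm; exact: cvg_fst.
        apply: cvg_norm; apply: cvgB; first exact: cvg_snd.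
        by apply: (cvgM (cvg_cst _)); exact: cvg_fst.
      have : nbhs w [set v : R * R | 0 < e * `|v.1| - `|v.2 - A x * v.1|].
        apply: open_nbhs_nbhs; split => //=.
        by rewrite wA subrr normr0 subr0 mulr_gt0// normr_gt0.
      by apply: filterS => v /=; rewrite subr_gt0.
    by move=> nw; exists ([set v | `|v.2 - A x * v.1| < e * `|v.1| ], setT);
      [split => //; exact: filterT|move=> [v y] [/= + _] _ _].
  pose E := [set p : (R * R) * M | psi (r * p.1.1) p.2 = phi (r * p.1.2) p.2].
  have cl : closed E.
    apply: (@closed_equalizer _ M
      (fun p : (R * R) * M => psi (r * p.1.1) p.2)
      (fun p => phi (r * p.1.2) p.2)); first exact: metric_hausdorff.
    - apply: continuous_flow_comp => // p; last exact: cvg_snd.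
      by apply: (cvgM (cvg_cst _)); apply: (cvg_comp _ _ cvg_fst); exact: cvg_fst.
    - apply: continuous_flow_comp => // p; last exact: cvg_snd.
      by apply: (cvgM (cvg_cst _)); apply: (cvg_comp _ _ cvg_fst); exact: cvg_snd.
  have : nbhs (w, x) (~` E).
    by apply: open_nbhs_nbhs; split; [exact: closed_openC|].
  by apply: filterS => -[v y] /= nvy _ lv; case: (nvy (lv r)).
apply: filterS => y Py.
(* Normalising [v] gives a unit direction proportional at [y]; the scaling factor cancels from the
   estimate. *)
pose v : R * R := (1, A y).
have v0 : 0 < `|v|.
  by rewrite prod_normE /= lt_max normr1 ltr01.
have vn : `| `|v|^-1 *: v| = 1.
  by rewrite normrZ normfV normr_id mulVf// gt_eqF.
have := Py _ vn vn.
rewrite /= mulrCA -mulrBr !normrM !mulr1 mulrCA.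
rewrite ltr_pM2l ?normr_gt0 ?invr_eq0 ?gt_eqF//.
rewrite normr1 mulr1 distrC; apply => r.
by rewrite hA /= -![_ *: _]/(_ * _) mulr1 mulrC mulrA.
Qed.
End commuting.

Theorem theoremA (R : realType) (M : metricType R) (phi : R -> M -> M) :
  compact [set: M] ->
  continuous_flow phi ->
  (forall x : M, ~ flow_fixed_point phi x) ->
  separating phi ->
  quasi_trivial_centralizer phi.
Proof.
move=> cM fphi nfix [delta d0 sep] psi fpsi comm.
have [eta eta0 small] := flow_small_time psi delta cM fpsi d0.
have orb x s : `|s| < eta -> flow_orbit phi x (psi s x).
  (* By commutation phi_t(psi_s x) is psi_s applied to phi_t x, so it stays [delta]-close to phi_t x
     for every t. *)
  by move=> se; apply: sep => t; rewrite -(commuting_flow comm); exact: small.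
have /choice[A hA] : forall x, exists a, forall s, psi s x = phi (a * s) x.
  by move=> x; apply: (slope_exists fphi fpsi comm x eta) => //; exact: orb.
exists A; split; first exact: (continuous_slope fphi fpsi).
  move=> t x; have [_ phi0 phiD] := fphi.
  (* Commutation carries the direction (1, A x) from [x] to [phi t x], where the slope is unique. *)
  have := slope_unique (psi := psi) fphi (phi t x) (1, A x) (A (phi t x)).
  rewrite /= mulr1 => <- // r /=.
  by rewrite (commuting_flow comm) hA -!phiD mulr1 mulrC addrC.
by move=> t x; exact: hA.
Qed.
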